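(* Let $X,Y\subseteq\mathsf{all}$ be such that $X\neq\emptyset$ and for all $x\in X$ there is $y\in Y$ with $y\ne x$. \begin{enumerate} \item If $\mathsf{osc}\notin X$ and $\mathsf{osc}\in Y$, then $(D_X,\mathrm{Sym}(\omega),R_Y)\le_T(\mathcal M,2^\omega,\not\ni)$. \item If $0\in X$ or $1\in X$, then $(\omega^\omega,\Phi_h,\in^\infty)\le_T(D_X,\mathrm{Sym}(\omega),R_Y)$ for every $h\in\omega^\omega$ with $h(n)\ge2^n+n+1$ for all $n$. \end{enumerate}
   Context: Relational systems: a relational system is a triple $\mathcal A=(A_-,A_+,A)$ with $A\subseteq A_-\times A_+$ such that for every $a_-\in A_-$ there is $a_+\in A_+$ with $a_-\,A\,a_+$, and for every $a_+\in A_+$ there is $a_-\in A_-$ for which $a_-\,A\,a_+$ fails. $\mathcal A\le_T\mathcal B$ (Tukey reducibility), for $\mathcal B=(B_-,B_+,B)$, means that there are functions $\varphi_-:A_-\to B_-$ and $\varphi_+:B_+\to A_+$ such that for all $a_-\in A_-$, $b_+\in B_+$: $\varphi_-(a_-)\,B\,b_+$ implies $a_-\,A\,\varphi_+(b_+)$. Density: $n\in\omega$ is identified with $\{0,\dots,n-1\}$. For $A\subseteq\omega$, $\underline d(A)=\liminf_n|A\cap n|/n$ and $\overline d(A)=\limsup_n|A\cap n|/n$; if they are equal, $d(A)$ denotes the common value; if $\underline d(A)<\overline d(A)$, write $d(A)=\mathsf{osc}$, where $\mathsf{osc}$ is a formal symbol. $\mathsf{all}=[0,1]\cup\{\mathsf{osc}\}$.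 $\mathrm{Sym}(\omega)$ is the set of permutations of $\omega$. $D_X$ is the collection of infinite-coinfinite sets $A\subseteq\omega$ with $d(A)\in X$. For $A\in D_X$ and $\pi\in\mathrm{Sym}(\omega)$, $A\,R_Y\,\pi$ means $d(\pi[A])\in Y$ and $d(\pi[A])\ne d(A)$. Slaloms: $\Phi_h$ is the set of functions $\phi:\omega\to[\omega]^{<\omega}$ with $|\phi(n)|\le h(n)$ for all $n$; $f\in^\infty\phi$ means $f(n)\in\phi(n)$ for infinitely many $n$. $\mathcal M$ is the ideal of meager subsets of $2^\omega$; in $(\mathcal M,2^\omega,\not\ni)$, $M\in\mathcal M$ is related to $x\in2^\omega$ iff $x\notin M$. *)

(* Defs.v *)
From HB Require Import structures.
From mathcomp Require Import all_boot all_order all_algebra finmap.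
From mathcomp Require Import all_classical all_reals all_analysis.

Set Implicit Arguments.
Unset Strict Implicit.
Unset Printing Implicit Defensive.

Import Order.TTheory GRing.Theory Num.Theory.
Import numFieldNormedType.Exports.

Local Open Scope classical_set_scope.
Local Open Scope ring_scope.

Record triple := Triple {
  neg : Type;
  pos : Type;
  related : neg -> pos -> Prop }.

Definition relational_system (A : triple) : Prop :=
  (forall a : neg A, exists b : pos A, related a b) /\
  (forall b : pos A, exists a : neg A, ~ related a b).

(* Tukey reducibility is only meaningful between relational systems, so that
   A <=_T B includes that both triples satisfy the relational-system axioms. *)
Definition tukey_le (A B : triple) : Prop :=
  [/\ relational_system A, relational_system B &
      exists (phi_neg : neg A -> neg B) (phi_pos : pos B -> pos A),
        forall (a : neg A) (b : pos B),
          related (phi_neg a) b -> related a (phi_pos b)].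

Definition infinite_coinfinite (A : set nat) : Prop :=
  infinite_set A /\ infinite_set (~` A).

Definition Sym : set (nat -> nat) := [set pi | bijective pi].

(* Densities are valued in [option R]: [Some r] is the real r, and [None] is
   the formal symbol osc. *)
Definition osc {R : realType} : option R := None.

Section Density.
Variable R : realType.
Implicit Types (A : set nat) (X Y : set (option R)).

(* The value at n = 0 is 0 / 0 = 0, which does not affect the limits. *)
Definition density_seq A : R^nat :=
  fun n => #|` fset_set (A `&` `I_n)|%fset%:R / n%:R.

Definition lower_density A : R := limn_inf (density_seq A).

Definition upper_density A : R := limn_sup (density_seq A).

Definition density A : option R :=
  if lower_density A < upper_density A then osc else Some (lower_density A).

Definition all_densities : set (option R) :=
  [set Some r | r in [set r : R | 0 <= r <= 1]] `|` [set osc].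

Definition D X : set (set nat) :=
  [set A | infinite_coinfinite A /\ X (density A)].

Definition density_rel Y A (pi : nat -> nat) : Prop :=
  Y (density (pi @` A)) /\ density (pi @` A) <> density A.

(* Here and below, a set S used as a type denotes the subtype of its elements. *)
Definition density_triple X Y : triple :=
  @Triple (D X) Sym
    (fun (A : D X) (pi : Sym) => density_rel Y (val A) (val pi)).

End Density.

Definition Phi (h : nat -> nat) : set (nat -> {fset nat}) :=
  [set phi | forall n, (#|` phi n| <= h n)%N].

Definition slalom_triple (h : nat -> nat) : triple :=
  @Triple (nat -> nat) (Phi h)
    (fun (f : nat -> nat) (phi : Phi h) =>
       infinite_set [set n | f n \in val phi n]).

Definition nowhere_dense (T : topologicalType) (A : set T) : Prop :=
  (closure A)° = set0.

Definition meager (T : topologicalType) : set (set T) :=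
  [set A | exists F : nat -> set T,
     (forall n, nowhere_dense (F n)) /\ A = \bigcup_n F n].

Definition meager_triple : triple :=
  @Triple (@meager cantor_space) cantor_space
    (fun (M : @meager cantor_space) (x : cantor_space) => ~ val M x).

(* Main.v *)
Require Import Defs.
From mathcomp Require Import all_boot all_order all_algebra finmap.
From mathcomp Require Import all_classical all_reals all_analysis.
From mathcomp Require Import zify lra.

(** The two halves have different sources.

    First half.  Category provides oscillation.  For a point x of the Cantor
    space, the length of the run of zeros that starts at position k codes a
    finite list of naturals; concatenating these lists, without repetitions and
    with the number k thrown in at stage k, gives an enumeration of the
    naturals ([listing]), and phi_pos x is the permutation inverse to it.  If A is
    infinite, any finite piece of x can be prolonged so that the next list
    consists of very many elements of A; so for x in a dense open set the
    image of A has relative frequency at least 2/3 below some large N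
    ([cylinder_dense_listing]).  With A infinite and coinfinite this applies to
    A and to its complement, hence outside a meager set phi_neg A of points x
    the image of A has upper density at least 2/3 and lower density at most
    1/3.  Its density is then osc, which lies in Y and, as osc is not in X,
    differs from the density of A.

    Second half.  Attach to f the set of the numbers 2 ^ n * (2 * f n + 1),
    of which there are at most n below 2 ^ n, so that its density is 0.  A
    permutation pi is sent to the slalom whose n-th entry collects the values
    v with pi (2 ^ n * (2 * v + 1)) < 2 ^ n; there are at most 2 ^ n of them.
    If f meets this slalom finitely often, then the image of the set is again
    enumerated by a sequence growing at least like 2 ^ n, and its density is
    still 0 ([cvg_density_image_slalom_set]).  When 1 rather than 0 belongs to
    X, take complements.

    Tukey reducibility also requires both sides to be relational systems, and
    for the density triple this is where most of the work lies: for every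
    permutation and every value v in all there must be a set of density v whose
    image has density v again ([density_in_two_orders]).  For v = osc a Baire
    generic set works, for v = 0 or 1 a very sparse set or its complement.  For
    0 < v < 1 a random set works, each number being chosen independently with
    probability v; this is made deterministic by the method of conditional
    expectations, applied to the squares of the deviations of the counts below
    the fourth powers in both orders ([conditional_expectations],
    [balanced_set]). *)

Import Order.TTheory GRing.Theory Num.Theory.
Import numFieldNormedType.Exports.

Local Open Scope classical_set_scope.
Local Open Scope ring_scope.
Set Implicit Arguments.
Unset Strict Implicit.
Unset Printing Implicit Defensive.

(** * Counting functions and densities *)

Definition count_below (A : set nat) (n : nat) : nat := \sum_(k < n) ((k : nat) \in A).

Lemma count_belowS A n : count_below A n.+1 = (count_below A n + (n \in A))%N.
Proof. by rewrite /count_below big_ord_recr. Qed.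

Lemma count_below_le A n : (count_below A n <= n)%N.
Proof.
elim: n => [|n IHn]; first by rewrite /count_below big_ord0.
by rewrite count_belowS; case: (n \in A); lia.
Qed.

Lemma count_belowC A n : (count_below (~` A) n + count_below A n = n)%N.
Proof.
elim: n => [|n IHn]; first by rewrite /count_below !big_ord0.
by rewrite !count_belowS in_setC; case: (n \in A) => /=; lia.
Qed.

Lemma count_below_lipschitz A m n : (m <= n)%N ->
  (count_below A m <= count_below A n <= count_below A m + (n - m))%N.
Proof.
elim: n => [|n IHn]; first by rewrite leqn0 => /eqP ->; rewrite subnn addn0 leqnn.
rewrite leq_eqVlt => /orP[/eqP <-|]; first by rewrite leqnn leq_addr.
rewrite ltnS => mn; rewrite count_belowS.
by have := IHn mn; case: (n \in A); lia.
Qed.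

Lemma card_fset_set_below (A : set nat) n :
  #|` fset_set (A `&` `I_n)|%fset = count_below A n.
Proof.
elim: n => [|n IHn].
  by rewrite II0 setI0 fset_set0 cardfs0 /count_below big_ord0.
have fin m : finite_set (A `&` `I_m) by apply: finite_setIr; exact: finite_II.
rewrite count_belowS -IHn; have [An|An] := boolP (n \in A).
  have -> : A `&` `I_n.+1 = n |` (A `&` `I_n).
    apply/seteqP; split => k /=.
      by case=> Ak; rewrite ltnS leq_eqVlt => /orP[/eqP ->|kn]; [left|right].
    by case=> [->|[Ak kn]]; split=> //; [rewrite inE in An|exact: ltnW].
  rewrite fset_setU1 // cardfsU1 in_fset_set //.
  have -> : (n \in A `&` `I_n) = false.
    by apply/negbTE/negP; rewrite inE => -[_] /=; rewrite ltnn.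
  by rewrite addnC.
rewrite addn0; congr (#|` fset_set _|%fset).
apply/seteqP; split => k /= [Ak]; last by move=> kn; split=> //; exact: ltnW.
rewrite ltnS leq_eqVlt => /orP[/eqP kn|//].
by move: An; rewrite -kn notin_setE.
Qed.

Section DensityCriteria.
Variable R : realType.
Implicit Types (A : set nat) (p : R).

Lemma density_seqE A n : density_seq R A n = (count_below A n)%:R / n%:R.
Proof. by rewrite /density_seq card_fset_set_below. Qed.

Lemma density_seq_itv A n : 0 <= density_seq R A n <= 1.
Proof.
rewrite density_seqE divr_ge0 //=; case: n => [|n]; first by rewrite invr0 mulr0.
by rewrite ler_pdivrMr ?ltr0n // mul1r ler_nat count_below_le.
Qed.

(** Convergence is reduced to inequalities without division; the factor K
    stands for the inverse of the tolerance. *)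
Lemma cvg_density_seq A p :
  (forall K : nat, exists N0 : nat, forall N, (N0 <= N)%N ->
     K%:R * `|(count_below A N)%:R - p * N%:R| <= N%:R) ->
  density_seq R A @ \oo --> p.
Proof.
move=> H; apply/cvgrPdist_le => /= e e0.
have [N0 HN] := H (Num.truncn e^-1).+1.
near=> N.
have N1 : (0 < N)%N by near: N; exists 1%N.
have NR : 0 < N%:R :> R by rewrite ltr0n.
rewrite density_seqE -[X in `|X - _|](mulfK (lt0r_neq0 NR)) -mulrBl normrM normfV.
rewrite (gtr0_norm NR) ler_pdivrMr // distrC.
have : (N0 <= N)%N by near: N; exists N0.
move/HN; set d := `|_| => Kd.
have d0 : 0 <= d by rewrite normr_ge0.
have eK : 1 <= e * (Num.truncn e^-1).+1%:R.
  by rewrite -ler_pdivrMl // mulr1 ltW // truncnS_gt.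
apply: (@le_trans _ _ (e * ((Num.truncn e^-1).+1%:R * d))).
  by rewrite mulrA ler_peMl.
by rewrite ler_pM2l.
Unshelve. all: by end_near. Qed.

Lemma density_Some A p : density_seq R A @ \oo --> p -> density R A = Some p.
Proof.
move=> cA; have [h1 h2] := cvg_limn_inf_sup cA.
by rewrite /density /lower_density /upper_density h1 h2 ltxx.
Qed.

Lemma cvg_density_seqC A p :
  density_seq R A @ \oo --> p -> density_seq R (~` A) @ \oo --> 1 - p.
Proof.
move=> cA.
have : (fun n => 1 - density_seq R A n) @ \oo --> 1 - p.
  by apply: cvgB => //; exact: cvg_cst.
apply: cvg_trans; apply: near_eq_cvg; near=> n.
have n0 : (0 < n)%N by near: n; exists 1%N.
have nR : n%:R != 0 :> R by rewrite pnatr_eq0 -lt0n.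
rewrite !density_seqE -{1}(divff nR) -mulrBl; congr (_ / _).
by rewrite -{1}(count_belowC A n) natrD addrK.
Unshelve. all: by end_near. Qed.

(** The constant 2/3 could be any number above 1/2: all that matters is that
    a set and its complement with this property force two distinct limit
    points of the frequencies. *)
Definition often_dense A :=
  forall n, exists2 N, (n <= N)%N & (2 * N <= 3 * count_below A N)%N.

Lemma often_dense_upper A : often_dense A ->
  forall n, exists2 N, (n <= N)%N & 2 / 3 <= density_seq R A N.
Proof.
move=> H n; have [N nN HN] := H n.+1; exists N; first exact: ltnW.
have N0 : 0 < N%:R :> R by rewrite ltr0n (leq_trans _ nN).
rewrite density_seqE ler_pdivlMr // mulrAC ler_pdivrMr // -!natrM ler_nat; lia.
Qed.

Lemma often_dense_osc A : often_dense A -> often_dense (~` A) ->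
  density R A = @osc R.
Proof.
move=> HA HC; rewrite /density.
have bd : bounded_fun (density_seq R A : R^o^nat).
  exists 1; split; first exact: num_real.
  move=> x x1 n _ /=; have /andP[h0 h1] := density_seq_itv A n.
  by rewrite ger0_norm // (le_trans h1) // ltW.
suff -> : lower_density R A < upper_density R A by [].
apply: (@le_lt_trans _ _ (1 / 3)); last apply: (@lt_le_trans _ _ (2 / 3)); last first.
- rewrite /upper_density limn_supE //; apply: lb_le_inf.
    by exists (sups (density_seq R A) 0%N); exists 0%N.
  move=> _ [n _ <-]; have [N nN hN] := often_dense_upper HA n.
  apply: le_trans hN _; apply: ub_le_sup; last by exists N.
  by exists 1 => _ [k _ <-]; have /andP[] := density_seq_itv A k.
- by lra.
- rewrite /lower_density limn_infE //; apply: ge_sup.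
    by exists (infs (density_seq R A) 0%N); exists 0%N.
  move=> _ [n _ <-]; have [N nN hN] := often_dense_upper HC n.+1.
  apply: (@le_trans _ _ (density_seq R A N)).
    apply: ge_inf; last by exists N => //=; exact: ltnW.
    by exists 0 => _ [k _ <-]; have /andP[] := density_seq_itv A k.
  have N0 : N%:R != 0 :> R by rewrite pnatr_eq0 -lt0n (leq_trans _ nN).
  have : density_seq R (~` A) N + density_seq R A N = 1.
    by rewrite !density_seqE -mulrDl -natrD count_belowC divff.
  by lra.
Qed.

Lemma count_below_finite A : finite_set A ->
  exists C, forall N, (count_below A N <= C)%N.
Proof.
move=> fA; exists #|` fset_set A|%fset => N; rewrite -card_fset_set_below.
apply: fsubset_leq_card; rewrite -fset_set_sub //; exact: finite_setIl.
Qed.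

Lemma cvg_density_seq_finite A : finite_set A -> density_seq R A @ \oo --> 0.
Proof.
move=> /count_below_finite[C HC]; apply: cvg_density_seq => K.
exists (K * C)%N => N HN; rewrite mul0r subr0 normr_nat -natrM ler_nat.
by apply: leq_trans HN; rewrite leq_mul2l HC orbT.
Qed.

Lemma often_dense_infinite A : often_dense A -> infinite_set A.
Proof.
move=> HA /count_below_finite[C HC]; have [N HN] := HA (2 * C).+1.
by have := HC N; lia.
Qed.

Lemma cvg_density_seq_infinite A p : p != 0 ->
  density_seq R A @ \oo --> p -> infinite_set A.
Proof.
move=> p0 cA /cvg_density_seq_finite/(cvg_unique _ cA) pe.
by move: p0; rewrite pe ?eqxx.
Qed.

(** If e n is at least (2 * K + 1) * n from n0 on, then only indices below
    n0 + N / (2 * K + 1) + 1 can contribute to the count below N. *)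
Lemma cvg_density_seq_sparse A (e : nat -> nat) : A `<=` range e ->
  (forall K, exists n0, forall n, (n0 <= n)%N -> (K * n <= e n)%N) ->
  density_seq R A @ \oo --> 0.
Proof.
move=> Ae He; apply: cvg_density_seq => K.
have [n0 Hn0] := He (2 * K).+1.
exists (2 * (K * (n0 + 1)))%N => N HN; rewrite mul0r subr0 normr_nat -natrM ler_nat.
suff : (count_below A N <= n0 + N %/ (2 * K).+1 + 1)%N.
  have := leq_divM N (2 * K).+1; set q := (N %/ _)%N; set c := count_below A N.
  nia.
rewrite -card_fset_set_below; set M := (n0 + _ + 1)%N.
apply: geq_card_fset_set; apply: card_le_trans (card_image_le e `I_M).
apply: subset_card_le => k [Ak /= kN]; have [n _ en] := Ae _ Ak.
exists n => //=; have [n0n|] := leqP n0 n; last first.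
  by move=> nn0; rewrite /M -addnA ltn_addr.
have := Hn0 _ n0n; rewrite en => enk.
suff : (n <= N %/ (2 * K).+1)%N.
  by move=> nq; rewrite /M addn1 ltnS (leq_trans nq) ?leq_addl.
by rewrite leq_divRL // mulnC (leq_trans enk) // ltnW.
Qed.

End DensityCriteria.

(** * Cylinders of the Cantor space and the Baire property *)

Lemma prefix_limit (T : eqType) (d : T) (s : nat -> seq T) :
  (forall n, prefix (s n) (s n.+1)) -> (forall n, n <= size (s n))%N ->
  {x : nat -> T | forall n i, (i < size (s n))%N -> x i = nth d (s n) i}.
Proof.
move=> s_prefix s_size.
have s_mono m n : (m <= n)%N -> prefix (s m) (s n).
  elim: n => [|n IHn]; first by rewrite leqn0 => /eqP ->; exact: prefix_refl.
  rewrite leq_eqVlt => /orP[/eqP <-|/IHn mn]; first exact: prefix_refl.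
  exact: prefix_trans mn (s_prefix n).
have s_nth m n i : (m <= n)%N -> (i < size (s m))%N -> nth d (s n) i = nth d (s m) i.
  by move=> /s_mono/prefixP[t ->] im; rewrite nth_cat im.
exists (fun i => nth d (s i.+1) i) => n i i_n.
have [ni|ni] := leqP n i.+1; first by rewrite (s_nth n).
by rewrite -(s_nth _ _ _ (ltnW ni)) // s_size.
Qed.

Definition cylinder (s : seq bool) : set cantor_space :=
  [set x | forall i, (i < size s)%N -> x i = nth false s i].

Lemma cylinder_catl s t : cylinder (s ++ t) `<=` cylinder s.
Proof.
move=> x xst i i_s; rewrite xst ?nth_cat ?i_s // size_cat.
by rewrite (leq_trans i_s) // leq_addr.
Qed.

Lemma open_cylinder s : open (cylinder s).
Proof.
elim/last_ind: s => [|s b IHs].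
  rewrite (_ : cylinder [::] = setT); first exact: openT.
  by apply/seteqP; split => // x _ i.
rewrite (_ : cylinder _ = cylinder s `&` (@proj nat (fun=> bool) (size s)) @^-1` [set b]).
  apply: openI => //; apply: open_comp; last exact: discrete_open.
  by move=> x _; exact: proj_continuous.
apply/seteqP; split => x.
  move=> xs; split; first by apply: (@cylinder_catl s [:: b]); rewrite cats1.
  by rewrite /= /proj xs ?size_rcons // nth_rcons ltnn eqxx.
move=> [xs xb] i; rewrite size_rcons ltnS leq_eqVlt nth_rcons => /orP[/eqP ->|i_s].
  by rewrite ltnn eqxx.
by rewrite i_s xs.
Qed.

(** The sets containing a cylinder around x form a filter, and convergence in
    the product topology is coordinatewise. *)
Lemma nbhs_cylinder (x : cantor_space) (A : set cantor_space) :
  nbhs x A -> exists n, cylinder (mkseq x n) `<=` A.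
Proof.
pose F : set_system cantor_space := [set A | exists n, cylinder (mkseq x n) `<=` A].
have F_filter : Filter F.
  split; first by exists 0%N.
  - move=> P Q [n nP] [m mQ]; exists (maxn n m) => y y_nm; split.
      apply: nP => i; rewrite size_mkseq => i_n; rewrite nth_mkseq //.
      rewrite y_nm ?size_mkseq ?nth_mkseq //; lia.
    apply: mQ => i; rewrite size_mkseq => i_n; rewrite nth_mkseq //.
    rewrite y_nm ?size_mkseq ?nth_mkseq //; lia.
  - by move=> P Q PQ [n nP]; exists n; exact: subset_trans nP PQ.
suff : F --> x by apply.
apply/cvg_sup => i B; rewrite nbhsE => -[C [[D oD DC] Cx] CB].
exists i.+1 => y y_i; apply: CB; rewrite -DC /= /proj y_i ?size_mkseq //.
by rewrite nth_mkseq //; move: Cx; rewrite -DC.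
Qed.

(** Equivalently, P contains a dense open set. *)
Definition cylinder_dense (P : set cantor_space) :=
  forall s, exists t, cylinder (s ++ t) `<=` P.

Lemma cylinder_denseI (P Q : set cantor_space) :
  cylinder_dense P -> cylinder_dense Q -> cylinder_dense (P `&` Q).
Proof.
move=> dP dQ s; have [t tP] := dP s; have [u uQ] := dQ (s ++ t).
exists (t ++ u) => x; rewrite catA => x_stu; split; last exact: uQ.
exact/tP/cylinder_catl/x_stu.
Qed.

Lemma nowhere_denseP (F : set cantor_space) :
  nowhere_dense F <-> cylinder_dense (~` F).
Proof.
split=> [F_nd s|F_d].
  have [x sx nFx] : exists2 x, cylinder s x & ~ closure F x.
    apply: contrapT => no_x.
    have : (closure F)° (fun i => nth false s i).
      rewrite /interior nbhsE; exists (cylinder s).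
        by split=> //; exact: open_cylinder.
      by move=> y sy; apply: contrapT => nFy; apply: no_x; exists y.
    by rewrite F_nd.
  have [B Bx BF] : exists2 B, nbhs x B & ~ (F `&` B !=set0).
    apply: contrapT => no_B; apply: nFx => B Bx.
    by apply: contrapT => BF; apply: no_B; exists B.
  have [n nB] := nbhs_cylinder Bx.
  exists (drop (size s) (mkseq x (size s + n))) => y y_st Fy; apply: BF.
  exists y; split=> //; apply: nB => i; rewrite size_mkseq => i_n.
  have := y_st i; rewrite size_cat size_drop size_mkseq addKn nth_cat nth_drop.
  have [i_s|s_i] := ltnP i (size s).
    by move=> ->; [rewrite nth_mkseq // sx|lia].
  by rewrite subnKC // !nth_mkseq //; [apply; lia|lia].
apply/seteqP; split=> // x; rewrite /interior => /nbhs_cylinder[n nF].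
have [t tF] := F_d (mkseq x n).
pose y : cantor_space := fun i => nth false (mkseq x n ++ t) i.
have yt : cylinder (mkseq x n ++ t) y by [].
have [|z [Fz /tF //]] := nF y (cylinder_catl yt) (cylinder (mkseq x n ++ t)).
rewrite nbhsE; exists (cylinder (mkseq x n ++ t)) => //.
by split=> //; exact: open_cylinder.
Qed.

(** The Baire category theorem for the Cantor space: pass from one cylinder to
    the next inside P 0, P 1, and so on, and take the limit branch. *)
Lemma cylinder_dense_bigcap (P : nat -> set cantor_space) :
  (forall n, cylinder_dense (P n)) -> \bigcap_n P n !=set0.
Proof.
move=> dP; have [f fP] := choice (fun ns : nat * seq bool => dP ns.1 ns.2).
(* The extra bit false guarantees that the lengths of the cylinders grow. *)
pose s := fix s n := if n is m.+1 then rcons (s m ++ f (m, s m)) false else [::].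
have [n|n|x xs] := @prefix_limit bool false s.
- by rewrite /= -cats1 -catA; exact: prefix_prefix.
- elim: n => //= n IHn; rewrite size_rcons size_cat ltnS (leq_trans IHn) //.
  exact: leq_addr.
exists x => n _; apply: (fP (n, s n)) => i /= i_n.
rewrite (xs n.+1) /= ?nth_rcons ?i_n // size_rcons; exact: ltnW.
Qed.

(** * Sets with prescribed density in two orders *)

Section ConditionalExpectations.
Variable R : realType.
Variables (p : R) (p01 : 0 <= p <= 1).

(** Derandomization.  E j s plays the conditional expectation, given the bits s
    already chosen, of a nonnegative cost number j; as it is an average of its
    two successors, some next bit does not increase a given finite sum of
    costs.  The cost number j enters the sum only once j bits are
    chosen, so that every sum is finite although there are infinitely many
    costs to control. *)
Lemma conditional_expectations (E : nat -> seq bool -> R) (c : nat -> R) (C : R) :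
  (forall j s, 0 <= E j s) ->
  (forall j s, p * E j (rcons s true) + (1 - p) * E j (rcons s false) = E j s) ->
  (forall s, E (size s) s <= c (size s)) ->
  (forall m, \sum_(j < m) c j <= C) ->
  exists x : nat -> bool, forall j m, (j < m)%N -> E j (mkseq x m) <= C.
Proof.
move=> E_ge0 E_mean E_new c_sum.
pose Phi (s : seq bool) : R := \sum_(j < (size s).+1) E j s.
pose next (s : seq bool) (b : bool) : R := \sum_(j < (size s).+1) E j (rcons s b).
have next_le s : exists b, next s b <= Phi s.
  have mean : p * next s true + (1 - p) * next s false = Phi s.
    by rewrite !mulr_sumr -big_split; apply: eq_bigr => j _ /=; rewrite E_mean.
  have [h|h] := leP (next s true) (Phi s); first by exists true.
  exists false; rewrite leNgt; apply/negP => h'.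
  have /andP[p0 p1] := p01.
  suff : 0 < p * (next s true - Phi s) + (1 - p) * (next s false - Phi s) by lra.
  have [->|p_neq0] := eqVneq p 0; first by lra.
  have p_gt0 : 0 < p by rewrite lt_def p_neq0.
  rewrite ltr_wpDr ?mulr_gt0 ?subr_gt0 //.
  by rewrite mulr_ge0 ?subr_ge0 // ltW.
have [f fP] := choice next_le.
pose s := fix s n := if n is m.+1 then rcons (s m) (f (s m)) else [::].
have s_size n : size (s n) = n by elim: n => //= n IHn; rewrite size_rcons IHn.
have [n|n|x xs] := @prefix_limit bool false s.
- by rewrite /= -cats1; exact: prefix_prefix.
- by rewrite s_size.
have sE m : mkseq x m = s m.
  apply: (@eq_from_nth _ false); rewrite size_mkseq ?s_size // => i i_m.
  by rewrite nth_mkseq // (xs m) ?s_size.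
have s_sum m : \sum_(j < m) E j (s m) <= \sum_(j < m) c j.
  elim: m => [|m IHm]; first by rewrite !big_ord0.
  have := fP (s m); rewrite /next /Phi s_size => /le_trans; apply.
  rewrite !big_ord_recr /= lerD //.
  by have := E_new (s m); rewrite s_size.
exists x => j m j_m; rewrite sE; apply: le_trans (c_sum m).
apply: le_trans (s_sum m); rewrite (bigD1 (Ordinal j_m)) //= lerDl.
exact: sumr_ge0.
Qed.

Section OneOrder.
Variables (tau : nat -> nat) (tau_inj : injective tau).

Definition deviation (N : nat) (s : seq bool) : R :=
  \sum_(k < N | (tau k < size s)%N) ((nth false s (tau k))%:R - p).

Definition undecided (N m : nat) : R := \sum_(k < N | (m <= tau k)%N) 1.

(** The conditional expectation of the squared deviation of the count below N,
    in the order of which tau is the enumeration, when the bits after s are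
    independent and equal to true with probability p: each undecided bit
    contributes its variance p * (1 - p). *)
Definition expected_square (N : nat) (s : seq bool) : R :=
  deviation N s ^+ 2 + p * (1 - p) * undecided N (size s).

Definition weight_at (N m : nat) : R := \sum_(k < N) (tau k == m)%:R.

Lemma weight_at01 N m : weight_at N m = 0 \/ weight_at N m = 1.
Proof.
have [/existsP[k /eqP tk]|/existsPn no_k] := boolP [exists k : 'I_N, tau k == m].
  right; rewrite /weight_at (bigD1 k) //= tk eqxx big1 ?addr0 // => i i_k.
  case: eqP => // ti; case/eqP: i_k; apply/val_inj/tau_inj; by rewrite ti tk.
by left; rewrite /weight_at big1 // => k _; rewrite (negbTE (no_k k)).
Qed.

Lemma deviation_rcons N s b :
  deviation N (rcons s b) = deviation N s + weight_at N (size s) * (b%:R - p).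
Proof.
rewrite /deviation /weight_at mulr_suml [LHS]big_mkcond [X in _ = X + _]big_mkcond.
rewrite -big_split; apply: eq_bigr => k _ /=; rewrite size_rcons nth_rcons.
rewrite ltnS; case: (ltngtP (tau k) (size s)) => _ /=.
- by rewrite mul0r addr0.
- by rewrite mul0r addr0.
- by rewrite mul1r add0r.
Qed.

Lemma undecidedS N m : undecided N m = undecided N m.+1 + weight_at N m.
Proof.
rewrite /undecided /weight_at [LHS]big_mkcond [X in _ = X + _]big_mkcond.
rewrite -big_split; apply: eq_bigr => k _ /=.
by case: ltngtP => h /=; rewrite ?addr0 ?add0r.
Qed.

(** The martingale property; the cross term vanishes since the new bit minus p
    has mean zero, and its variance is moved from one summand to the other. *)
Lemma expected_square_mean N s :
  p * expected_square N (rcons s true) +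
  (1 - p) * expected_square N (rcons s false) = expected_square N s.
Proof.
rewrite /expected_square !deviation_rcons !size_rcons (undecidedS N (size s)).
have tE : true%:R = 1 :> R by []. have fE : false%:R = 0 :> R by [].
by rewrite tE fE; case: (weight_at01 N (size s)) => ->; lra.
Qed.

Lemma undecided_itv N m : 0 <= undecided N m <= N%:R.
Proof.
rewrite sumr_ge0 //= /undecided big_mkcond.
have -> : N%:R = \sum_(k < N) 1 :> R by rewrite sumr_const card_ord.
by apply: ler_sum => k _; case: ifP.
Qed.

Lemma deviation_sqr_le N s : deviation N s ^+ 2 <= expected_square N s.
Proof.
have /andP[u0 _] := undecided_itv N (size s).
have /andP[p0 p1] := p01.
by rewrite lerDl mulr_ge0 // mulr_ge0 // subr_ge0.
Qed.

Lemma expected_square_ge0 N s : 0 <= expected_square N s.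
Proof.
by apply: le_trans (deviation_sqr_le N s); exact: sqr_ge0.
Qed.

(** At most size s terms of the sum are present, because tau is injective. *)
Lemma deviation_le N s : `|deviation N s| <= (size s)%:R.
Proof.
elim/last_ind: s => [|s b IHs].
  by rewrite /deviation big_pred0 ?normr0.
rewrite deviation_rcons size_rcons -natr1; apply: le_trans (ler_normD _ _) _.
apply: lerD => //; have /andP[p0 p1] := p01.
case: (weight_at01 N (size s)) => ->; first by rewrite mul0r normr0.
rewrite mul1r ler_norml; case: b; rewrite /= ?mulr1n ?mulr0n; apply/andP; split; lra.
Qed.

Lemma expected_square_le N s :
  expected_square N s <= (size s)%:R ^+ 2 + N%:R.
Proof.
have /andP[u0 u1] := undecided_itv N (size s).
have /andP[p0 p1] := p01.
apply: lerD.
  by rewrite -real_normK ?num_real // lerXn2r ?nnegrE ?normr_ge0 ?deviation_le.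
by apply: le_trans u1; rewrite ler_piMl //; nra.
Qed.

Lemma deviation_total N (A : set nat) m : (forall k, (k < N)%N -> (tau k < m)%N) ->
  deviation N (mkseq (fun i => i \in A) m) =
    (count_below (tau @^-1` A) N)%:R - p * N%:R.
Proof.
move=> tau_m; rewrite /deviation size_mkseq.
rewrite (eq_bigl xpredT) => [|k]; last by rewrite tau_m.
rewrite sumrB sumr_const card_ord mulr_natr; congr (_ - _).
rewrite /count_below natr_sum; apply: eq_bigr => k _.
by rewrite nth_mkseq // tau_m.
Qed.

End OneOrder.

End ConditionalExpectations.

Section Balanced.
Variable R : realType.

Lemma sum_telescope_le (m : nat) :
  \sum_(j < m) (4 / (j.+1%:R * j.+2%:R)) <= 4 :> R.
Proof.
suff -> : \sum_(j < m) (4 / (j.+1%:R * j.+2%:R)) = 4 - 4 / m.+1%:R :> R.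
  by rewrite gerBl divr_ge0.
elim: m => [|m IHm]; first by rewrite big_ord0 divr1 subrr.
rewrite big_ord_recr /= IHm.
have m1 : m.+1%:R != 0 :> R by rewrite pnatr_eq0.
have m2 : m.+2%:R != 0 :> R by rewrite pnatr_eq0.
suff : m.+1%:R^-1 - m.+2%:R^-1 = (m.+1%:R * m.+2%:R)^-1 :> R.
  by move=> <-; move: (_^-1) (_^-1) => a b; lra.
have m12 : m.+1%:R * m.+2%:R != 0 :> R by rewrite mulf_neq0.
apply: (mulfI m12); rewrite divff // mulrBr mulrAC divff // mul1r.
by rewrite -mulrA divff // mulr1 -[m.+2]addn1 natrD; lra.
Qed.

(** The cost number j is the sum of the squared deviations below j ^ 4 in both
    orders, divided by (j + 1) ^ 6.  At the moment when j bits are chosen, its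
    conditional expectation is at most 2 * (j ^ 2 + j ^ 4) / (j + 1) ^ 6, and
    these bounds are summable; keeping the total at most 4 keeps each deviation
    at most 2 * (j + 1) ^ 3, which is small compared to j ^ 4. *)
Lemma balanced_set (tau : nat -> nat) (p : R) : injective tau -> 0 <= p <= 1 ->
  exists A : set nat, forall j,
    `|(count_below A (j ^ 4))%:R - p * (j ^ 4)%:R| <= 2 * (j.+1 ^ 3)%:R /\
    `|(count_below (tau @^-1` A) (j ^ 4))%:R - p * (j ^ 4)%:R|
      <= 2 * (j.+1 ^ 3)%:R.
Proof.
move=> tau_inj p01.
pose V j s : R := expected_square p id (j ^ 4) s + expected_square p tau (j ^ 4) s.
pose c (j : nat) : R := 4 / (j.+1%:R * j.+2%:R).
have id_inj : injective (@id nat) by [].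
have [||s||x xP] := @conditional_expectations R p p01
    (fun j s => V j s / (j.+1 ^ 6)%:R) c 4.
- by move=> j s; rewrite divr_ge0 // addr_ge0 // expected_square_ge0.
- move=> j s; rewrite !mulrA -mulrDl; congr (_ / _).
  have m1 := expected_square_mean p id_inj (j ^ 4) s.
  have m2 := expected_square_mean p tau_inj (j ^ 4) s.
  by rewrite /V; lra.
- rewrite /c ler_pdivlMr -?natrM ?ltr0n // mulrAC ler_pdivrMr ?ltr0n ?expn_gt0 //.
  set m := size s.
  have hV : V m s <= (2 * (m ^ 2 + m ^ 4))%:R.
    have h1 := expected_square_le p01 id_inj (m ^ 4) s.
    have h2 := expected_square_le p01 tau_inj (m ^ 4) s.
    by rewrite /V natrM natrD natrX; lra.
  apply: (@le_trans _ _ ((2 * (m ^ 2 + m ^ 4))%:R * (m.+1 * m.+2)%:R)).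
    by rewrite ler_wpM2r.
  by rewrite -!natrM ler_nat; nia.
- exact: sum_telescope_le.
exists [set i | x i] => j.
have xE M : mkseq x M = mkseq (fun i => i \in [set i | x i]) M.
  by congr mkseq; apply/funext => i; rewrite mem_setE.
have V_le m : (j < m)%N -> V j (mkseq x m) <= 4 * (j.+1 ^ 6)%:R.
  by move=> j_m; have := xP _ _ j_m; rewrite ler_pdivrMr // ltr0n expn_gt0.
have bound_le (d : R) : d ^+ 2 <= 4 * (j.+1 ^ 6)%:R -> `|d| <= 2 * (j.+1 ^ 3)%:R.
  move=> hd; rewrite -(@ler_pXn2r _ 2) ?nnegrE ?normr_ge0 //.
  rewrite real_normK ?num_real // exprMn; apply: le_trans hd _.
  by rewrite (_ : (j.+1 ^ 6)%:R = (j.+1 ^ 3)%:R ^+ 2) -?natrX -?expnM //; lra.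
(* All numbers that matter for the counts below j ^ 4 are decided at stage M. *)
pose M := (j + j ^ 4 + \sum_(k < j ^ 4) tau k).+1.
have V_M : V j (mkseq x M) <= 4 * (j.+1 ^ 6)%:R by apply: V_le; rewrite /M; lia.
have tau_M k : (k < j ^ 4)%N -> (tau k < M)%N.
  move=> k_j; by rewrite /M ltnS (bigD1 (Ordinal k_j)) //= addnCA leq_addr.
have id_M k : (k < j ^ 4)%N -> (id k < M)%N by rewrite /M /=; lia.
have := deviation_sqr_le p01 id (j ^ 4) (mkseq x M).
have := deviation_sqr_le p01 tau (j ^ 4) (mkseq x M).
have ge_id := expected_square_ge0 p01 id (j ^ 4) (mkseq x M).
have ge_tau := expected_square_ge0 p01 tau (j ^ 4) (mkseq x M).
rewrite /V in V_M.
rewrite !xE in V_M ge_id ge_tau *.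
rewrite (deviation_total p _ tau_M) (deviation_total p _ id_M) => h_tau h_id.
by split; apply: bound_le; [apply: le_trans h_id _|apply: le_trans h_tau _]; lra.
Qed.

(** Between two consecutive fourth powers the count moves by at most
    (j + 1) ^ 4 - j ^ 4 <= 4 * (j + 1) ^ 3, so the error below N is at most
    10 * (j + 1) ^ 3 when j ^ 4 <= N < (j + 1) ^ 4. *)
Lemma cvg_density_seq_fourth (A : set nat) (p : R) : 0 <= p <= 1 ->
  (forall j, `|(count_below A (j ^ 4))%:R - p * (j ^ 4)%:R| <= 2 * (j.+1 ^ 3)%:R) ->
  density_seq R A @ \oo --> p.
Proof.
move=> /andP[p0 p1] H; apply: cvg_density_seq => K.
exists ((80 * K).+1 ^ 4)%N => N HN.
have [j /andP[jN Nj]] : exists j, (j ^ 4 <= N < j.+1 ^ 4)%N.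
  elim: N {HN} => [|N [j /andP[jN Nj]]]; first by exists 0%N.
  have [Nj1|Nj1] := leqP (j.+1 ^ 4) N.+1.
    by exists j.+1; rewrite Nj1 (leq_ltn_trans Nj) // ltn_exp2r.
  by exists j; rewrite Nj1 (leq_trans jN).
have Kj : (80 * K < j)%N.
  by rewrite -ltnS -(@ltn_exp2r _ _ 4) // (leq_ltn_trans HN).
have /andP[c1 c2] := count_below_lipschitz A jN.
have gap : (N - j ^ 4 <= 4 * j.+1 ^ 3)%N.
  suff : (j.+1 ^ 4 <= j ^ 4 + 4 * j.+1 ^ 3)%N by lia.
  by rewrite !expnS expn0; nia.
have j3 : (j.+1 ^ 3 <= 8 * j ^ 3)%N.
  have -> : (8 * j ^ 3 = (2 * j) ^ 3)%N by rewrite expnMn.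
  by rewrite leq_exp2r //; lia.
have small : (K * (10 * j.+1 ^ 3) <= N)%N.
  apply: leq_trans jN; apply: (@leq_trans (K * (80 * j ^ 3))).
    by rewrite leq_mul2l; apply/orP; right; lia.
  by rewrite mulnCA mulnA (expnS j 3) leq_mul2r ltnW ?orbT.
have dist : `|(count_below A N)%:R - p * N%:R| <= (10 * j.+1 ^ 3)%:R.
  set g := (N - j ^ 4)%N in c2 gap.
  set c := count_below A N in c1 c2 *; set c0 := count_below A (j ^ 4) in c1 c2.
  have := H j; rewrite -/c0 ler_norml => /andP[h1 h2].
  have NE : N%:R = (j ^ 4)%:R + g%:R :> R by rewrite -natrD subnKC.
  have c1R : c0%:R <= c%:R :> R by rewrite ler_nat.
  have c2R : c%:R <= c0%:R + g%:R :> R by rewrite -natrD ler_nat.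
  have gR : g%:R <= 4 * (j.+1 ^ 3)%:R :> R by rewrite -natrM ler_nat.
  have g0 : 0 <= g%:R :> R by [].
  have pg1 : p * g%:R <= g%:R by rewrite ler_piMl.
  have pg0 : 0 <= p * g%:R by rewrite mulr_ge0.
  by rewrite NE mulrDr natrM ler_norml; apply/andP; split; lra.
apply: (@le_trans _ _ (K%:R * (10 * j.+1 ^ 3)%:R)); first by rewrite ler_wpM2l.
by rewrite -natrM ler_nat.
Qed.

Lemma balanced_density (tau : nat -> nat) (p : R) : injective tau -> 0 <= p <= 1 ->
  exists A : set nat, density_seq R A @ \oo --> p /\
    density_seq R (tau @^-1` A) @ \oo --> p.
Proof.
move=> tau_inj p01; have [A HA] := balanced_set tau_inj p01; exists A.
by split; apply: cvg_density_seq_fourth => // j; have [] := HA j.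
Qed.
End Balanced.

Lemma card_le_preimage (T U : Type) (f : T -> U) (B : set U) :
  injective f -> (f @^-1` B #<= B)%card.
Proof.
move=> f_inj; have fE : (f @` (f @^-1` B) #= f @^-1` B)%card.
  by apply: inj_card_eq => x y _ _; exact: f_inj.
rewrite -(card_le_eql fE); apply: subset_card_le; exact: image_preimage_subset.
Qed.

Lemma count_below_sub (A B : set nat) n :
  (forall k, (k < n)%N -> A k -> B k) -> (count_below A n <= count_below B n)%N.
Proof.
move=> AB; apply: leq_sum => k _.
by case: (boolP (_ \in A)) => //; rewrite inE => /(AB _ (ltn_ord k)) Bk; rewrite mem_set.
Qed.

Lemma count_below_preimage_II (tau : nat -> nat) m n : injective tau ->
  (count_below (tau @^-1` `I_m) n <= m)%N.
Proof.
move=> tau_inj; rewrite -card_fset_set_below; apply: geq_card_fset_set.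
apply: card_le_trans (card_le_preimage `I_m tau_inj).
by apply: subset_card_le => k [].
Qed.

Lemma infinite_range_ge (e : nat -> nat) : (forall n, (n <= e n)%N) ->
  infinite_set (range e).
Proof.
move=> e_ge fin; pose M := \max_(k <- fset_set (range e)) k.
have := e_ge M.+1; rewrite leqNgt => /negP; apply; rewrite ltnS.
by apply: leq_bigmax_seq => //; rewrite in_fset_set // mem_set //; exists M.+1.
Qed.

Lemma can_image_preimage (T U : Type) (f : T -> U) (g : U -> T) (A : set T) :
  cancel f g -> cancel g f -> f @` A = g @^-1` A.
Proof.
move=> fK gK; apply/seteqP; split => y; first by move=> [x Ax <-]; rewrite /= fK.
by move=> Ay; exists (g y).
Qed.

Lemma expn2_superlinear K n : (K.*2.+1 <= n)%N -> (K * n <= 2 ^ n)%N.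
Proof.
move=> /subnKC <-; elim: (n - _)%N => {n} [|n IHn].
  rewrite addn0 expnS -addnn expnD; have := ltn_expl K (isT : 1 < 2)%N.
  by set q := (2 ^ K)%N; nia.
rewrite addnS; move: IHn; set m := (K.*2.+1 + n)%N => IHn.
rewrite expnS mulnS mul2n -addnn leq_add //.
have : (K <= m)%N by rewrite /m; lia.
move=> K_m.
by apply: leq_trans K_m (ltnW (ltn_expl _ _)).
Qed.

Lemma superlinear_expn2 (e : nat -> nat) n0 :
  (forall n, (n0 <= n)%N -> (2 ^ n <= e n)%N) ->
  forall K, exists m, forall n, (m <= n)%N -> (K * n <= e n)%N.
Proof.
move=> e_ge K; exists (n0 + K.*2.+1)%N => n n_ge.
have K_n : (K.*2.+1 <= n)%N by lia.
by apply: leq_trans (expn2_superlinear K_n) (e_ge _ _); lia.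
Qed.

(** Prolong s by sufficiently many bits b: among the first 3 * size s + n
    entries of tau only those below size s can escape the value b. *)
Lemma cylinder_dense_often (tau : nat -> nat) (b : bool) n : injective tau ->
  cylinder_dense [set x | exists2 N, (n <= N)%N &
    (2 * N <= 3 * count_below (tau @^-1` [set i | x i = b]) N)%N].
Proof.
move=> tau_inj s; pose N := (3 * size s + n)%N.
pose M := (\sum_(k < N) tau k).+1.
exists (nseq M b) => x x_sb; exists N; first exact: leq_addl.
suff : (count_below (~` (tau @^-1` [set i | x i = b])) N <= size s)%N.
  by have := count_belowC (tau @^-1` [set i | x i = b]) N; rewrite /N; lia.
apply: leq_trans (count_below_preimage_II (size s) N tau_inj).
apply: count_below_sub => k k_N /= x_k; rewrite ltnNge; apply/negP => s_k.
have tk_M : (tau k < M)%N by rewrite /M ltnS (bigD1 (Ordinal k_N)) //= leq_addr.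
apply: x_k; rewrite x_sb.
  by rewrite nth_cat (leq_gtF s_k) nth_nseq (leq_ltn_trans (leq_subr _ _) tk_M).
by rewrite size_cat size_nseq (leq_trans tk_M) // leq_addl.
Qed.

Lemma often_dense_set (tau : nat -> nat) : injective tau ->
  exists A, [/\ often_dense A, often_dense (~` A),
    often_dense (tau @^-1` A) & often_dense (tau @^-1` (~` A))].
Proof.
move=> tau_inj; have id_inj : injective (@id nat) by [].
have [x xP] := cylinder_dense_bigcap (fun n =>
  cylinder_denseI
    (cylinder_denseI (cylinder_dense_often true n id_inj)
                     (cylinder_dense_often false n id_inj))
    (cylinder_denseI (cylinder_dense_often true n tau_inj)
                     (cylinder_dense_often false n tau_inj))).
exists [set i | x i = true].
have -> : ~` [set i | x i = true] = [set i | x i = false].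
  by apply/seteqP; split => i /=; case: (x i).
by split=> n; have [[? ?] [? ?]] := xP n I.
Qed.

(** Glue a bijection between the sets with one between the complements. *)
Lemma bijective_image (A B : set nat) :
  infinite_coinfinite A -> infinite_coinfinite B ->
  exists2 pi : nat -> nat, bijective pi & pi @` A = B.
Proof.
have card_inf (C D : set nat) : infinite_set C -> infinite_set D -> (C #= D)%card.
  move=> infC infD; apply: (card_eq_trans (eq_card_nat _ infC)).
    exact: sub_countable (subset_card_le (subsetT C)) _.
  rewrite card_eq_sym; apply: eq_card_nat infD.
  exact: sub_countable (subset_card_le (subsetT D)) _.
move=> [infA infAC] [infB infBC].
have /card_set_bijP[f [f_fun f_inj f_surj]] := card_inf _ _ infA infB.
have /card_set_bijP[g [g_fun g_inj g_surj]] := card_inf _ _ infAC infBC.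
pose pi x := if x \in A then f x else g x.
have piA x : A x -> pi x = f x by move=> Ax; rewrite /pi mem_set.
have piAC x : ~ A x -> pi x = g x by move=> Ax; rewrite /pi memNset.
exists pi; last first.
  apply/seteqP; split => y; first by move=> [x Ax <-]; rewrite piA //; exact: f_fun.
  by move=> /f_surj[x Ax <-]; exists x => //; rewrite piA.
rewrite -setTT_bijective; split=> //.
  move=> x y _ _; have [Ax|nAx] := pselect (A x); have [Ay|nAy] := pselect (A y).
  - by rewrite !piA //; apply: f_inj; rewrite inE.
  - rewrite piA // piAC // => fg; exfalso.
    by apply: (g_fun y nAy); rewrite -fg; exact: f_fun.
  - rewrite piAC // piA // => gf; exfalso.
    by apply: (g_fun x nAx); rewrite gf; exact: f_fun.
  - by rewrite !piAC //; apply: g_inj; rewrite inE.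
move=> y _; have [/f_surj[x Ax <-]|/g_surj[x Ax <-]] := pselect (B y).
  by exists x => //; rewrite piA.
by exists x => //; rewrite piAC.
Qed.

Section ExistenceOfDensities.
Variable R : realType.
Implicit Types (X Y : set (option R)).

(** Three kinds of witnesses: Baire generic for osc, sparse in both orders (or the
    complement of such a set) for 0 and 1, and balanced for the values between. *)
Lemma density_in_two_orders (pi : nat -> nat) (v : option R) :
  bijective pi -> @all_densities R v ->
  exists A, [/\ infinite_coinfinite A, density R A = v & density R (pi @` A) = v].
Proof.
move=> [tau piK tauK] v_all; have tau_inj := can_inj tauK.
have image_pi A := can_image_preimage A piK tauK.
have sparse : exists A, [/\ infinite_set A, density_seq R A @ \oo --> 0
    & density_seq R (pi @` A) @ \oo --> 0].
  have /choice[e eP] n : exists m, (2 ^ n <= m)%N && (2 ^ n <= pi m)%N.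
    (* Larger than the preimage under pi of any number below 2 ^ n. *)
    pose S := \sum_(k < 2 ^ n) tau k; exists (2 ^ n + S).+1.
    rewrite ltnW ?ltnS ?leq_addr //= leqNgt; apply/negP => lt_m.
    have le_S k : (k < 2 ^ n)%N -> (tau k <= S)%N.
      by move=> k_n; rewrite /S (bigD1 (Ordinal k_n)) //= leq_addr.
    by have := le_S _ lt_m; rewrite piK; lia.
  exists (range e); split.
  - apply: infinite_range_ge => n; apply: leq_trans (ltnW (ltn_expl n (isT : 1 < 2)%N)) _.
    by have /andP[] := eP n.
  - apply: cvg_density_seq_sparse; first exact: subset_refl.
    by apply: (superlinear_expn2 (n0 := 0)) => n _; have /andP[] := eP n.
  - rewrite image_comp; apply: cvg_density_seq_sparse; first exact: subset_refl.
    by apply: (superlinear_expn2 (n0 := 0)) => n _; have /andP[] := eP n.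
case: v_all => [[p /andP[p0 p1] <-]|->]; last first.
  have [A [dA dAC dtA dtAC]] := often_dense_set tau_inj.
  exists A; split; first by split; exact: often_dense_infinite.
    exact: often_dense_osc.
  by rewrite image_pi; exact: often_dense_osc.
have [p_eq0|p_neq0] := eqVneq p 0.
  have [A [infA cA cpiA]] := sparse; exists A; rewrite p_eq0; split.
  - split=> //; apply: (cvg_density_seq_infinite (p := 1 - 0 : R)).
      by rewrite subr0 oner_eq0.
    exact: cvg_density_seqC.
  - exact: density_Some.
  - exact: density_Some.
have [p_eq1|p_neq1] := eqVneq p 1.
  have [A [infA cA cpiA]] := sparse; exists (~` A); rewrite p_eq1 -[1]subr0; split.
  - split; last by rewrite setCK.
    apply: (cvg_density_seq_infinite (p := 1 - 0 : R)).
      by rewrite subr0 oner_eq0.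
    exact: cvg_density_seqC.
  - exact/density_Some/cvg_density_seqC.
  - by rewrite image_pi -preimage_setC -(image_pi A); exact/density_Some/cvg_density_seqC.
have [|A [cA ctA]] := balanced_density tau_inj (p := p); first exact/andP.
exists A; split; [split| |].
- exact: cvg_density_seq_infinite cA.
- by apply: cvg_density_seq_infinite (cvg_density_seqC cA); rewrite subr_eq0 eq_sym.
- exact: density_Some.
- by rewrite image_pi; exact: density_Some.
Qed.

(** Every A is solved by a permutation onto a set with another density in Y; no
    permutation solves a set whose density it preserves. *)
Lemma density_triple_relational_system X Y :
  X `<=` @all_densities R -> Y `<=` @all_densities R -> X !=set0 ->
  (forall x, X x -> exists y, Y y /\ y <> x) ->
  relational_system (density_triple X Y).
Proof.
move=> hX hY [v Xv] hXY; split => /= [[A DA]|[pi Spi]].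
  have [icA /hXY[y [Yy yA]]] := set_mem DA.
  have id_bij : bijective (@id nat) by exists id.
  have [B [icB dB _]] := density_in_two_orders id_bij (hY _ Yy).
  have [pi pi_bij piA] := bijective_image icA icB.
  have Spi : pi \in Sym by rewrite inE.
  by exists (SigSub Spi); rewrite /density_rel /= piA dB.
have pi_bij : bijective pi := set_mem Spi.
have [A [icA dA dpiA]] := density_in_two_orders pi_bij (hX _ Xv).
have DA : A \in D X by rewrite inE; split=> //; rewrite dA.
by exists (SigSub DA) => -[_] /=; rewrite dA dpiA.
Qed.

End ExistenceOfDensities.

(** * Slaloms *)

(** The factor 2 ^ n bounds the n-th point from below and the odd factor encodes
    its value. *)
Definition slalom_point (n v : nat) : nat := 2 ^ n * v.*2.+1.

Lemma slalom_point_ge n v : (2 ^ n <= slalom_point n v)%N.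
Proof. by rewrite /slalom_point leq_pmulr. Qed.

Lemma slalom_point_inj n : injective (slalom_point n).
Proof.
move=> v w /eqP; rewrite /slalom_point eqn_pmul2l ?expn_gt0 // => /eqP[].
exact: double_inj.
Qed.

Definition slalom_set (f : nat -> nat) : set nat :=
  range (fun n => slalom_point n (f n)).

Definition early_values (pi : nat -> nat) (n : nat) : set nat :=
  [set v | (pi (slalom_point n v) < 2 ^ n)%N].

Lemma early_values_card (pi : nat -> nat) n : injective pi ->
  (early_values pi n #<= `I_(2 ^ n))%card.
Proof.
move=> pi_inj; apply: (@card_le_preimage _ _ (pi \o slalom_point n) `I_(2 ^ n)).
exact: inj_comp pi_inj (@slalom_point_inj n).
Qed.

Lemma slalom_set_infinite f : infinite_set (slalom_set f).
Proof.
apply: infinite_range_ge => n; apply: leq_trans (slalom_point_ge n (f n)).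
exact/ltnW/ltn_expl.
Qed.

Lemma slalom_triple_relational_system (h : nat -> nat) :
  (forall n, 0 < h n)%N -> relational_system (slalom_triple h).
Proof.
move=> h_gt0; split => /= [f|[phi Phi_phi]].
  have Pf : (fun n => [fset f n]%fset) \in Phi h.
    by rewrite inE => n; rewrite cardfs1.
  exists (SigSub Pf) => /=; rewrite (_ : mkset _ = setT); first exact: infinite_nat.
  by apply/seteqP; split => // n _ /=; rewrite inE.
exists (fun n => (\max_(k <- phi n) k).+1) => /infinite_setN0[n /= n_phi].
have := @leq_bigmax_seq _ _ xpredT id _ n_phi isT.
by rewrite ltnn.
Qed.

Section Slaloms.
Variable R : realType.

Lemma cvg_density_slalom_set f : density_seq R (slalom_set f) @ \oo --> 0.
Proof.
apply: cvg_density_seq_sparse; first exact: subset_refl.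
by apply: (superlinear_expn2 (n0 := 0)) => n _; exact: slalom_point_ge.
Qed.

(** From some n on the n-th point is moved to 2 ^ n or above, so the image is as
    sparse as the set itself. *)
Lemma cvg_density_image_slalom_set f pi :
  ~ infinite_set [set n | early_values pi n (f n)] ->
  density_seq R (pi @` slalom_set f) @ \oo --> 0.
Proof.
move=> /contrapT/finite_fsetP[E EE]; rewrite image_comp.
apply: cvg_density_seq_sparse; first exact: subset_refl.
apply: (superlinear_expn2 (n0 := (\max_(n <- E) n).+1)) => n n_E /=.
rewrite leqNgt; apply/negP => early.
have nE : n \in E by have : [set` E] n by rewrite -EE.
by move: n_E; rewrite ltnNge => /negP; apply; exact: leq_bigmax_seq.
Qed.

Lemma slalom_tukey_density (X Y : set (option R)) (h : nat -> nat) :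
  relational_system (density_triple X Y) -> X (Some 0) \/ X (Some 1) ->
  (forall n, 2 ^ n <= h n)%N ->
  tukey_le (slalom_triple h) (density_triple X Y).
Proof.
move=> DXY_rel X01 h_ge; split=> //.
  apply: slalom_triple_relational_system => n; apply: leq_trans (h_ge n).
  by rewrite expn_gt0.
have /choice[phi_neg neg_P] (f : nat -> nat) : exists A : D X, forall pi : Sym,
    density_rel Y (val A) (val pi) ->
    infinite_set [set n | early_values (val pi) n (f n)].
  have cf := cvg_density_slalom_set f.
  have infC : infinite_set (~` slalom_set f).
    apply: (cvg_density_seq_infinite (p := 1 - 0 : R)); last exact: cvg_density_seqC.
    by rewrite subr0 oner_eq0.
  case: X01 => [X0|X1].
    have DA : slalom_set f \in D X.
      rewrite inE; split; last by rewrite (density_Some cf).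
      by split=> //; exact: slalom_set_infinite.
    exists (SigSub DA) => -[pi Spi] [_] /=; apply: contra_notP.
    by move=> /cvg_density_image_slalom_set/density_Some ->; rewrite (density_Some cf).
  have DA : ~` slalom_set f \in D X.
    rewrite inE; split.
      by split=> //; rewrite setCK; exact: slalom_set_infinite.
    by rewrite (density_Some (cvg_density_seqC cf)) subr0.
  exists (SigSub DA) => -[pi Spi] [_] /=; apply: contra_notP.
  move=> /cvg_density_image_slalom_set cpi; rewrite (density_Some (cvg_density_seqC cf)).
  have [tau piK tauK] := set_mem Spi.
  rewrite (can_image_preimage _ piK tauK) in cpi *.
  rewrite (can_image_preimage _ piK tauK) preimage_setC.
  by rewrite (density_Some (cvg_density_seqC cpi)).
have /choice[phi_pos pos_P] (pi : Sym) : exists phi : Phi h,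
    forall n v, early_values (val pi) n v -> v \in val phi n.
  have pi_inj : injective (val pi).
    by case: pi => pi Spi; have [tau /can_inj] := set_mem Spi.
  have fin n : finite_set (early_values (val pi) n).
    by apply/finite_set_leP; exists (2 ^ n)%N; exact: early_values_card.
  have Pphi : (fun n => fset_set (early_values (val pi) n)) \in Phi h.
    rewrite inE => n; apply: leq_trans (h_ge n).
    exact/geq_card_fset_set/early_values_card.
  by exists (SigSub Pphi) => n v; rewrite /= in_fset_set // inE.
exists phi_neg, phi_pos => f pi /neg_P; apply: sub_infinite_set.
by move=> n /pos_P.
Qed.

End Slaloms.

(** * Generic permutations and the two reductions *)

(** The value 0 in the absence of a later true bit makes the permutation below
    available for every point of the Cantor space. *)
Definition run_length (x : nat -> bool) (k : nat) : nat :=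
  if pselect (exists m, x (k + m)%N) is left h then ex_minn h else 0%N.

Lemma run_lengthE (x : nat -> bool) k m :
  x (k + m)%N -> (forall i, (i < m)%N -> ~~ x (k + i)%N) -> run_length x k = m.
Proof.
move=> x_m x_lt_m; rewrite /run_length; case: pselect => [h|]; last by case; exists m.
case: ex_minnP => r x_r r_min; apply/eqP; rewrite eqn_leq r_min //= leqNgt.
by apply/negP => /x_lt_m; rewrite x_r.
Qed.

Definition run_block (x : nat -> bool) (k : nat) : seq nat :=
  odflt [::] (choice.unpickle (run_length x k)).

(** Stage k adds k itself, so that every number gets listed whatever x is. *)
Fixpoint listing (x : nat -> bool) (k : nat) : seq nat :=
  if k is k'.+1 then
    listing x k' ++
      undup [seq v <- rcons (run_block x k') k' | v \notin listing x k']
  else [::].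

Lemma listing_uniq x k : uniq (listing x k).
Proof.
elim: k => //= k IHk; rewrite cat_uniq IHk undup_uniq andbT /=.
by apply/hasPn => v; rewrite mem_undup mem_filter => /andP[].
Qed.

Lemma mem_listingS x k v :
  v \in rcons (run_block x k) k -> v \in listing x k.+1.
Proof.
move=> v_b; rewrite /= mem_cat mem_undup mem_filter v_b andbT.
by case: (v \in listing x k).
Qed.

Lemma size_listing_ge x k : (k <= size (listing x k))%N.
Proof.
rewrite -[k in (k <= _)%N](size_iota 0); apply: uniq_leq_size (iota_uniq _ _) _.
move=> v; rewrite mem_iota /= add0n; elim: k => // k IHk.
rewrite ltnS leq_eqVlt => /orP[/eqP ->|/IHk v_k].
  by apply: mem_listingS; rewrite mem_rcons mem_head.
by rewrite /= mem_cat v_k.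
Qed.

Lemma size_listingS x k :
  (size (listing x k.+1) <= size (listing x k) + (size (run_block x k)).+1)%N.
Proof.
rewrite /= size_cat leq_add2l -(size_rcons _ k).
by apply: leq_trans (size_undup _) _; rewrite size_filter count_size.
Qed.

Lemma eq_listing x y k : (forall i, (i < k)%N -> run_length x i = run_length y i) ->
  listing x k = listing y k.
Proof.
elim: k => //= k IHk xy; rewrite /run_block xy // IHk // => i i_k.
by apply: xy; exact: ltnW.
Qed.

Lemma listing_bijection (x : nat -> bool) : exists e : nat -> nat,
  bijective e /\
  forall k i, (i < size (listing x k))%N -> e i = nth 0%N (listing x k) i.
Proof.
have [k|k|e eE] := @prefix_limit nat 0%N (listing x).
- exact: prefix_prefix.
- exact: size_listing_ge.
exists e; split=> //; rewrite -setTT_bijective; split=> // [i j _ _ eij|v _].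
  pose k := (maxn i j).+1; have k_size := size_listing_ge x k.
  have i_k : (i < size (listing x k))%N by apply: leq_trans k_size; rewrite ltnS leq_maxl.
  have j_k : (j < size (listing x k))%N by apply: leq_trans k_size; rewrite ltnS leq_maxr.
  apply/eqP; rewrite -(nth_uniq 0%N i_k j_k (listing_uniq x k)).
  by rewrite -!eE // eij.
have v_in : v \in listing x v.+1 by apply: mem_listingS; rewrite mem_rcons mem_head.
by exists (index v (listing x v.+1)) => //; rewrite (eE v.+1) ?index_mem ?nth_index.
Qed.

Lemma count_below_listing x e k (A : set nat) :
  (forall i, (i < size (listing x k))%N -> e i = nth 0%N (listing x k) i) ->
  count_below (e @^-1` A) (size (listing x k)) = count (mem A) (listing x k).
Proof.
move=> eE; rewrite -sum1_count big_mkcond (big_nth 0%N) big_mkord.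
apply: eq_bigr => i _.
rewrite (_ : (nat_of_ord i \in e @^-1` A) = (e i \in A)) // eE //.
Qed.

(** The bit true after s fixes the first [size s + 1] runs, hence the list L of
    that stage; the following run codes a list u of elements of A more than
    twice as long as L, which then dominates the next stage. *)
Lemma cylinder_dense_listing (A : set nat) n : infinite_set A ->
  cylinder_dense [set x | exists2 k, (n <= size (listing x k))%N &
    (2 * size (listing x k) <= 3 * count (mem A) (listing x k))%N].
Proof.
move=> infA s; pose m := size s.
pose y i := nth false (rcons s true) i; pose L := listing y m.+1.
have [B BA B_size] := infinite_set_fset (2 * size L + 2 + n) infA.
pose u : seq nat := B.
exists (true :: rcons (nseq (choice.pickle u) false) true) => x x_st.
have x_y i : (i <= m)%N -> x i = y i.
  move=> i_m; rewrite /y; have : cylinder (rcons s true) x.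
    apply: (@cylinder_catl _ (rcons (nseq (choice.pickle u) false) true)).
    by rewrite cat_rcons.
  by apply; rewrite size_rcons ltnS.
have y_m : y m = true by rewrite /y nth_rcons ltnn eqxx.
have run_y i : (i < m.+1)%N -> run_length x i = run_length y i.
  rewrite ltnS => i_m; have : exists r, y (i + r)%N by exists (m - i)%N; rewrite subnKC.
  move=> ex_r; case: (ex_minnP ex_r) => r y_r r_min.
  have ir_m : (i + r <= m)%N by rewrite -leq_subRL // r_min // subnKC.
  have y_lt j : (j < r)%N -> ~~ y (i + j)%N.
    by move=> j_r; apply/negP => /r_min; rewrite leqNgt j_r.
  rewrite (run_lengthE y_r y_lt); apply: run_lengthE; first by rewrite x_y.
  by move=> j j_r; rewrite x_y ?y_lt //; lia.
have run_m : run_length x m.+1 = choice.pickle u.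
  apply: run_lengthE => [|i i_u].
    rewrite x_st ?nth_cat ?size_cat /= ?size_rcons ?size_nseq; last by rewrite -/m; lia.
    rewrite ltnNge -/m (leq_trans (leqnSn m)) ?leq_addr //= addSn subSn ?leq_addr //=.
    by rewrite addKn nth_rcons size_nseq ltnn eqxx.
  rewrite x_st ?nth_cat ?size_cat /= ?size_rcons ?size_nseq; last by rewrite -/m; lia.
  rewrite ltnNge -/m (leq_trans (leqnSn m)) ?leq_addr //= addSn subSn ?leq_addr //=.
  by rewrite addKn nth_rcons size_nseq i_u nth_nseq i_u.
have block_m : run_block x m.+1 = u by rewrite /run_block run_m choice.pickleK.
have L_m : listing x m.+1 = L by exact: eq_listing.
have u_count : (size u <= count (mem A) (listing x m.+2))%N.
  rewrite -size_filter; apply: uniq_leq_size; first exact: fset_uniq.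
  move=> v v_u; rewrite mem_filter mem_listingS ?mem_rcons ?block_m ?inE ?v_u ?orbT //.
  by rewrite andbT; apply/mem_set/BA.
have := size_listingS x m.+1; rewrite block_m L_m => L_size.
have := count_size (mem A) (listing x m.+2) => count_le.
have {}B_size : (2 * size L + 2 + n <= size u)%N by [].
by exists m.+2; lia.
Qed.

Lemma meager_triple_relational_system : relational_system meager_triple.
Proof.
split=> [[M M_meager]|x].
  have [F [F_nd ME]] := set_mem M_meager.
  have [x xF] := cylinder_dense_bigcap (fun n => (nowhere_denseP (F n)).1 (F_nd n)).
  by exists x; rewrite /= ME => -[n _]; exact: xF.
have M_meager : [set x] \in @meager cantor_space.
  rewrite inE; exists (fun=> [set x]); split; last by rewrite bigcup_const.
  move=> _; apply/nowhere_denseP => s; exists [:: ~~ x (size s)] => y ys /= yx.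
  have := ys (size s); rewrite size_cat addn1 ltnSn nth_cat ltnn subnn yx /= => /(_ isT).
  by case: (x _).
by exists (SigSub M_meager) => /=; apply; exact.
Qed.

(** A goes to the complement of the intersection of the dense sets that make its
    image and the image of its complement often dense; x goes to the permutation
    inverse to its listing. *)
Lemma density_tukey_meager (R : realType) (X Y : set (option R)) :
  relational_system (density_triple X Y) -> ~ X osc -> Y osc ->
  tukey_le (density_triple X Y) meager_triple.
Proof.
move=> DXY_rel X_osc Y_osc; split=> //; first exact: meager_triple_relational_system.
have /choice[phi_pos pos_P] (x : cantor_space) : exists pi : Sym, forall A : set nat,
    (forall n, exists2 k, (n <= size (listing x k))%N &
      (2 * size (listing x k) <= 3 * count (mem A) (listing x k))%N) ->
    often_dense (val pi @` A).
  have [e [[pi eK piK] eE]] := listing_bijection x.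
  have Spi : pi \in Sym by rewrite inE; exists e.
  exists (SigSub Spi) => A A_often n /=; have [k n_k A_k] := A_often n.
  exists (size (listing x k)) => //.
  by rewrite (can_image_preimage A piK eK) (count_below_listing A (eE k)).
pose G (A : set nat) n : set cantor_space := [set x | exists2 k,
  (n <= size (listing x k))%N &
  (2 * size (listing x k) <= 3 * count (mem A) (listing x k))%N].
have /choice[phi_neg neg_P] (A : D X) : exists M : @meager cantor_space,
    forall x, ~ val M x -> forall n, G (val A) n x /\ G (~` val A) n x.
  case: A => A DA /=; have [[infA infAC] _] := set_mem DA.
  have M_meager : \bigcup_n ~` (G A n `&` G (~` A) n) \in @meager cantor_space.
    rewrite inE; exists (fun n => ~` (G A n `&` G (~` A) n)); split=> // n.
    apply/nowhere_denseP; rewrite setCK.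
    by apply: cylinder_denseI; exact: cylinder_dense_listing.
  exists (SigSub M_meager) => x /= x_M n; apply: contrapT => xG.
  by apply: x_M; exists n.
exists phi_neg, phi_pos => A x /neg_P x_G.
have d_osc : density R (val (phi_pos x) @` val A) = osc.
  have [tau piK tauK] := set_mem (valP (phi_pos x)).
  apply: often_dense_osc; first by apply: pos_P => n; have [] := x_G n.
  have -> : ~` (val (phi_pos x) @` val A) = val (phi_pos x) @` (~` val A).
    by rewrite !(can_image_preimage _ piK tauK) preimage_setC.
  by apply: pos_P => n; have [] := x_G n.
split; first by rewrite d_osc.
have [_ XA] := set_mem (valP A).
by rewrite d_osc => oscA; apply: X_osc; rewrite oscA.
Qed.

Theorem theorem16 (R : realType) (X Y : set (option R))
    (hX : X `<=` @all_densities R) (hY : Y `<=` @all_densities R)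
    (hX0 : X !=set0)
    (hXY : forall x : option R, X x -> exists y : option R, Y y /\ y <> x) :
  (~ X osc -> Y osc -> tukey_le (density_triple X Y) meager_triple) /\
  (X (Some 0) \/ X (Some 1) ->
   forall h : nat -> nat, (forall n : nat, (2 ^ n + n + 1 <= h n)%N) ->
   tukey_le (slalom_triple h) (density_triple X Y)).
Proof.
have DXY_rel := density_triple_relational_system hX hY hX0 hXY.
split=> [|X01 h h_ge]; first exact: density_tukey_meager.
apply: slalom_tukey_density => // n; apply: leq_trans (h_ge n).
by rewrite -addnA leq_addr.
Qed.
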